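(* Let $W$ be an arbitrary graphon. Then, for an arbitrary function $f:[0,1]^2\to[0,1]$ and an arbitrary finite simple graph $F$, \[|t(F,W)-t(F,f\circ W)|\leq |E(F)|\,(\sup(W)-\sup(f))\,\Delta(\{W>\sup(f)\}),\] where $E(F)$ denotes the set of all edges of $F$ and $\Delta(\{W>\sup(f)\})$ denotes the area of the set $\{W>\sup(f)\}=\{(x,y)\in[0,1]^2:\ W(x,y)>\sup(f)\}$.
   Context: A graphon is a measurable function $W:[0,1]^2\to[0,1]$ with $W(x,y)=W(y,x)$ for all $x,y\in[0,1]$. A fuzzy subset of $[0,1]^2$ is an arbitrary function $f:[0,1]^2\to[0,1]$ (not necessarily measurable); $\sup(f)=\sup_{x\in[0,1]^2}f(x)$. For fuzzy subsets $f,g$ of $[0,1]^2$, $f\circ g$ is the fuzzy subset given by $(f\circ g)(s)=\sup_{x\in[0,1]^2}\min(f(x),g(s))$ for $s\in[0,1]^2$. If $W$ is a graphon and $f$ is a fuzzy subset of $[0,1]^2$, then $f\circ W$ is a graphon. For a finite simple graph $F$ with nodes labelled $1,\dots,k$ and a graphon $W$, the density of $F$ in $W$ is \[t(F,W)=\int_{[0,1]^k}\prod_{ij\in E(F)}W(x_i,x_j)\,dx_1dx_2\cdots dx_k.\] Area means two-dimensional Lebesgue measure. *)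

(* Defs.v *)
From HB Require Import structures.
From mathcomp Require Import all_boot all_order all_algebra.
From mathcomp Require Import all_classical all_reals all_analysis.

Set Implicit Arguments.
Unset Strict Implicit.
Unset Printing Implicit Defensive.
Import Order.TTheory GRing.Theory Num.Theory.
Import numFieldNormedType.Exports.

Local Open Scope classical_set_scope.
Local Open Scope ring_scope.

(* Lebesgue measure on the Borel sets of R^n, with R^n the type of n-tuples, by
   recursion on n: a point mass for n = 0; the product measure on R * R^n,
   carried to R^(n.+1) by prepending the first coordinate, otherwise. *)
Section borel_lebesgue.
Context (R : realType).
Local Notation mR := (measurableTypeR R).

Definition tuple_cons (n : nat) (p : mR * n.-tuple mR) : n.+1.-tuple mR :=
  [tuple of p.1 :: p.2].

Lemma measurable_tuple_cons n :
  measurable_fun [set: mR * n.-tuple mR] (@tuple_cons n).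
Proof. exact: measurable_cons. Qed.

Section step.
Context (n : nat) (mu : {sigma_finite_measure set (n.-tuple mR) -> \bar R}).

Definition borel_lebesgue_step : set (n.+1.-tuple mR) -> \bar R :=
  pushforward (lebesgue_measure \x mu)%E (@tuple_cons n).

Let step0 : borel_lebesgue_step set0 = 0%E.
Proof. by rewrite /borel_lebesgue_step /pushforward preimage_set0 measure0. Qed.

Let step_ge0 A : (0 <= borel_lebesgue_step A)%E.
Proof. exact: (measure_ge0 (lebesgue_measure \x mu)%E). Qed.

Let step_sigma_additive : semi_sigma_additive borel_lebesgue_step.
Proof.
move=> F mF tF mUF; rewrite /borel_lebesgue_step /pushforward preimage_bigcup.
apply: (@measure_semi_sigma_additive _ _ _ (lebesgue_measure \x mu)%E).
- move=> i; rewrite -[X in measurable X]setTI.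
  by apply: measurable_tuple_cons => //; exact: mF.
- apply/trivIsetP => i j _ _ ij; rewrite -preimage_setI.
  by move/trivIsetP : tF => /(_ _ _ I I ij) ->; rewrite preimage_set0.
- rewrite -preimage_bigcup -[X in measurable X]setTI.
  by apply: measurable_tuple_cons.
Qed.

HB.instance Definition _ := isMeasure.Build _ _ _ borel_lebesgue_step
  step0 step_ge0 step_sigma_additive.

Let step_sigma_finite : sigma_finite [set: n.+1.-tuple mR] borel_lebesgue_step.
Proof.
have /sigma_finiteP[F [FT ndF Foo]] := sigma_finiteT (@lebesgue_measure R).
have /sigma_finiteP[G [GT ndG Goo]] := sigma_finiteT mu.
pose uncons (x : n.+1.-tuple mR) : mR * n.-tuple mR :=
  (thead x, [tuple of behead x]).
have consK : cancel (@tuple_cons n) uncons.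
  by case=> x y; congr pair; apply/val_inj.
have munc : measurable_fun [set: n.+1.-tuple mR] uncons.
  apply: measurable_fun_pair; first exact: measurable_tnth.
  exact: measurable_behead.
exists (fun i => uncons @^-1` (F i `*` G i)).
  apply/esym; rewrite -subTset => x _.
  have [i _ Fix] : (\bigcup_i F i) (uncons x).1 by rewrite -FT.
  have [j _ Gjx] : (\bigcup_i G i) (uncons x).2 by rewrite -GT.
  exists (maxn i j) => //; split.
    by move: Fix; exact/subsetPset/ndF/leq_maxl.
  by move: Gjx; exact/subsetPset/ndG/leq_maxr.
move=> i; have [mF Ffin] := Foo i; have [mG Gfin] := Goo i; split.
  by rewrite -[X in measurable X]setTI; apply: munc => //; exact: measurableX.
rewrite /borel_lebesgue_step /pushforward -comp_preimage.
rewrite (_ : uncons \o @tuple_cons n = id); last by apply/funext; exact: consK.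
by rewrite preimage_id product_measure1E// lte_mul_pinfty// ge0_fin_numE.
Qed.

HB.instance Definition _ := Measure_isSigmaFinite.Build _ _ _
  borel_lebesgue_step step_sigma_finite.

End step.

Fixpoint borel_lebesgue (n : nat) :
    {sigma_finite_measure set (n.-tuple mR) -> \bar R} :=
  match n with
  | 0 => \d_[tuple]
  | m.+1 => borel_lebesgue_step (borel_lebesgue m)
  end.

End borel_lebesgue.

(* "Measurable" means Lebesgue measurable. The library's sigma-algebras on
   R * R and on tuples are the Borel ones; the Lebesgue sigma-algebra is their
   completion, obtained as the Caratheodory-measurable sets of the outer measure
   induced by the Borel measure. *)
Section lebesgue.
Context (R : realType).
Local Notation mR := (measurableTypeR R).

Definition borel_lebesgue2 : {measure set (mR * mR) -> \bar R} :=
  (lebesgue_measure \x lebesgue_measure)%E.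

Definition plane : measurableType _ := caratheodory_type (borel_lebesgue2^*)%mu.

Definition lebesgue2 : {measure set plane -> \bar R} :=
  @completed_measure_extension _ _ _ borel_lebesgue2.

Definition area (A : set (R * R)) : R := fine (lebesgue2 A).

Definition space (n : nat) : measurableType _ :=
  caratheodory_type ((borel_lebesgue R n)^*)%mu.

Definition lebesgue (n : nat) : {measure set (space n) -> \bar R} :=
  @completed_measure_extension _ _ _ (borel_lebesgue R n).

Definition unit_square : set (R * R) := `[0, 1]%classic `*` `[0, 1]%classic.

Definition unit_cube (n : nat) : set (n.-tuple R) :=
  [set x | forall i, tnth x i \in `[0, 1]].

End lebesgue.

(* Functions on [0,1]^2 are represented by functions on R * R of which only the
   values on the unit square are constrained or used. *)
Section graphons.
Context (R : realType).
Implicit Types W f g : R * R -> R.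
Local Notation square := (@unit_square R).

Definition fuzzy_subset f := forall p, square p -> 0 <= f p <= 1.

Record graphon W : Prop := Graphon {
  graphon_measurable :
    @measurable_fun _ _ (plane R) (measurableTypeR R) square W;
  graphon_fuzzy : fuzzy_subset W;
  graphon_sym : forall x y, square (x, y) -> W (x, y) = W (y, x)
}.

Definition fuzzy_sup f : R := sup [set f p | p in square].

Definition fuzzy_comp f g : R * R -> R :=
  fun s => sup [set Num.min (f x) (g s) | x in square].

End graphons.

Record simple_graph (k : nat) := SimpleGraph {
  adj : rel 'I_k;
  adj_sym : symmetric adj;
  adj_irr : irreflexive adj
}.

(* Each edge ij is listed once, as the pair (i, j) with i < j. *)
Definition edges (k : nat) (F : simple_graph k) : {set 'I_k * 'I_k} :=
  [set e : 'I_k * 'I_k | (e.1 < e.2)%N && adj F e.1 e.2]%SET.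

Definition density (R : realType) (k : nat) (F : simple_graph k)
    (W : R * R -> R) : R :=
  \int[lebesgue R k]_(x in @unit_cube R k)
     \prod_(e in edges F) W (tnth x e.1, tnth x e.2).

(* Main.v *)
Require Import Defs.
From mathcomp Require Import all_boot all_order all_algebra.
From mathcomp Require Import all_classical all_reals all_analysis.
From mathcomp Require Import measurable_realfun.

Set Implicit Arguments.
Unset Strict Implicit.
Unset Printing Implicit Defensive.
Import Order.TTheory GRing.Theory Num.Theory.
Import numFieldNormedType.Exports.

Local Open Scope classical_set_scope.
Local Open Scope ring_scope.

(** For s in the unit square, (f o W)(s) is min(sup f, W(s)), because
    truncation at W(s) commutes with suprema ([fuzzy_compE]). Hence W and f o W
    agree off the set A = {W > sup f}, and on A they differ by
    W - sup f <= sup W - sup f. A product of numbers in [0,1] moves by at most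
    the sum of the moves of its factors ([dist_prod_le]), so the integrands of
    the two densities differ at x by at most (sup W - sup f) times the number of
    edges ij with (x_i, x_j) in A. Integrating over the cube
    ([Rintegral_le_sum_indic]), each edge contributes at most the area of A.

    This last fact, and the measurability of x |-> W(x_i, x_j), which is needed
    to compare the integrals, rest on one property of the projection
    x |-> (x_i, x_j) with i < j: over the cube it does not increase measure.
    For Borel sets this is Fubini's theorem by induction on the dimension
    ([borel_lebesgue_coord2_le]). Covering an arbitrary set by Borel sets, it
    passes to outer measures ([le_mu_ext_preimage]). So preimages of null sets
    are null, and then preimages of Lebesgue measurable sets, which are Borel up
    to arbitrarily small outer measure, are Lebesgue measurable
    ([caratheodory_preimage]). The mere Borel measurability of the projection
    would not give this, W being only Lebesgue measurable. *)

(** * Preimages under a map that does not increase measure *)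

(** If B is measurable and contains A, splitting X along A instead of B costs at
    most the outer measure of B \ A, so A splits every X up to any e > 0. *)
Lemma caratheodory_approx (R : realType) (T : Type)
    (mu : {outer_measure set T -> \bar R}) (A : set T) :
  (forall e : R, 0 < e -> exists B, [/\ mu.-caratheodory B, A `<=` B &
     (mu (B `\` A) <= e%:E)%E]) -> mu.-caratheodory A.
Proof.
move=> approx; apply: le_caratheodory_measurable => X.
apply/lee_addgt0Pr => e /approx[B [cB AB BAe]].
rewrite (cB X) -addeA; apply: leeD.
  by apply: le_outer_measure; exact: setIS.
apply: (@le_trans _ _ (mu ((X `&` ~` B) `|` (B `\` A)))).
  apply: le_outer_measure => x [Xx nAx].
  by have [Bx|nBx] := pselect (B x); [right|left].
by apply: (le_trans (outer_measureU2 _ _ _)); rewrite leeD2l.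
Qed.

Section pullback.
Context d1 d2 (T1 : measurableType d1) (T2 : measurableType d2) (R : realType).
Context (m1 : {measure set T1 -> \bar R}) (m2 : {measure set T2 -> \bar R}).
Context (D : set T1) (phi : T1 -> T2).
Hypothesis mD : measurable D.
Hypothesis mphi : measurable_fun [set: T1] phi.
Hypothesis le_phi : forall B, measurable B ->
  (m1 (D `&` phi @^-1` B) <= m2 B)%E.

Let mpre B : measurable B -> measurable (D `&` phi @^-1` B).
Proof.
by move=> mB; apply: measurableI => //; rewrite -[X in measurable X]setTI;
  exact: mphi.
Qed.

(** The preimage of a countable measurable cover of A is a cover of the preimage
    of A, of no larger total measure. *)
Lemma le_mu_ext_preimage A :
  ((m1^*)%mu (D `&` phi @^-1` A) <= (m2^*)%mu A)%E.
Proof.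
apply: le_ereal_inf_tmp => _ [B [mB AB] <-].
apply: (@le_trans _ _ (\sum_(k <oo) m1 (D `&` phi @^-1` B k))%E).
  apply: ereal_inf_lbound; exists (fun k => D `&` phi @^-1` B k) => //.
  split=> [k|x [Dx /AB[k _ Bkx]]]; first exact: mpre.
  by exists k.
by apply: lee_nneseries => // k _; exact: le_phi.
Qed.

(** A set of finite outer measure has a measurable cover B of almost the same
    outer measure; when A is Caratheodory measurable, B \ A is therefore small,
    and so is its preimage, which makes the preimage of B a good approximation
    of that of A. *)
Lemma caratheodory_preimage A : (m2^*)%mu.-caratheodory A ->
  ((m2^*)%mu A < +oo)%E -> (m1^*)%mu.-caratheodory (D `&` phi @^-1` A).
Proof.
move=> cA Afin; apply: caratheodory_approx => e e0.
have /(lb_ereal_inf_adherent e0)[_ [B [mB AB] <-] Be] :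
    (m2^*)%mu A \is a fin_num by rewrite ge0_fin_numE ?outer_measure_ge0.
have mUB : measurable (\bigcup_k B k) by exact: bigcupT_measurable.
exists (D `&` phi @^-1` (\bigcup_k B k)); split.
- by apply: sub_caratheodory; apply: sub_sigma_algebra; exact: mpre.
- by move=> x [Dx /AB].
- rewrite (_ : _ `\` _ = D `&` phi @^-1` ((\bigcup_k B k) `\` A)); last first.
    apply/seteqP; split=> x /=.
      by move=> [[Dx Bx] nDA]; split=> //; split=> // Ax; apply: nDA.
    by move=> [Dx [Bx nAx]]; split=> // -[_ /nAx].
  apply: (le_trans (le_mu_ext_preimage _)).
  have Ale : ((m2^*)%mu (\bigcup_k B k) <= (m2^*)%mu A + e%:E)%E.
    rewrite measurable_mu_extE//; apply: le_trans (ltW Be).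
    exact: measure_sigma_subadditive.
  move: Ale; rewrite (cA (\bigcup_k B k)) (setIidr AB) leeD2lE//.
  by rewrite ge0_fin_numE ?outer_measure_ge0.
Qed.

End pullback.

(** * Projections of the cube: Borel sets *)

Section borel.
Context (R : realType).
Local Notation mR := (measurableTypeR R).
Local Notation lambda := (@lebesgue_measure R).

Lemma measurable_unit_cube n : measurable (@unit_cube R n : set (n.-tuple mR)).
Proof.
rewrite (_ : @unit_cube R n = \bigcap_(i in [set: 'I_n])
    ((fun x : n.-tuple mR => tnth x i) @^-1` `[0, 1]%classic)); last first.
  by apply/seteqP; split=> x; [move=> h i _; exact: h|move=> h i; exact: h].
apply: fin_bigcap_measurable => // i _; rewrite -[X in measurable X]setTI.
by apply: (@measurable_tnth _ mR) => //; exact: measurable_itv.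
Qed.

Lemma tuple_cons_unit_cube n :
  @tuple_cons R n @^-1` (@unit_cube R n.+1) =
  `[0, 1]%classic `*` (@unit_cube R n).
Proof.
apply/seteqP; split=> -[x y] /=.
  move=> h; split=> [|i]; first exact: (h ord0).
  by have := h (lift ord0 i); rewrite tnthS.
move=> [x01 y01] i; case: (unliftP ord0 i) => [j|] ->; last by rewrite tnth0.
by rewrite tnthS; exact: y01.
Qed.

Lemma borel_lebesgue_rect n (A : set mR) (B : set (n.-tuple mR)) :
  measurable A -> measurable B ->
  (lambda \x borel_lebesgue R n)%E (A `*` B) =
  (lambda A * borel_lebesgue R n B)%E.
Proof. exact: product_measure1E. Qed.

Lemma lebesgue_measure_itv01 : lambda `[0, 1]%classic = 1%E.
Proof. by rewrite lebesgue_measure_itv/= lte_fin ltr01 oppr0 adde0. Qed.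

Lemma borel_lebesgue_unit_cube n : borel_lebesgue R n (@unit_cube R n) = 1%E.
Proof.
elim: n => [|n IH].
  by rewrite /= diracE mem_set// => -[].
rewrite /= /borel_lebesgue_step /pushforward tuple_cons_unit_cube.
rewrite borel_lebesgue_rect ?IH ?lebesgue_measure_itv01 ?mule1//.
exact: measurable_unit_cube.
Qed.

Lemma measurable_cube_preimage n d (T : measurableType d)
    (phi : n.-tuple mR -> T) (B : set T) :
  measurable_fun [set: n.-tuple mR] phi -> measurable B ->
  measurable (@unit_cube R n `&` phi @^-1` B : set (n.-tuple mR)).
Proof.
move=> mphi mB; apply: measurableI; first exact: measurable_unit_cube.
by rewrite -[X in measurable X]setTI; exact: mphi.
Qed.

(** The cylinder over C is a box whose sides, apart from C cut down to [0, 1],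
    are unit intervals. The induction peels off the first coordinate. *)
Lemma borel_lebesgue_coord_le n (i : 'I_n) (C : set mR) : measurable C ->
  (borel_lebesgue R n (@unit_cube R n `&` (fun x => tnth x i) @^-1` C) <=
   lambda C)%E.
Proof.
move=> mC; elim: n i => [[]//|n IH] i.
rewrite /= /borel_lebesgue_step /pushforward preimage_setI tuple_cons_unit_cube.
case: (unliftP ord0 i) => [j|] ->.
  rewrite (_ : _ `&` _ = `[0, 1]%classic `*`
      (@unit_cube R n `&` (fun x => tnth x j) @^-1` C)); last first.
    apply/seteqP; split=> -[x y] /=; rewrite tnthS; last by case=> ? [].
    by case=> -[].
  rewrite borel_lebesgue_rect ?lebesgue_measure_itv01 ?mul1e//.
  by apply: measurable_cube_preimage => //; exact: measurable_tnth.
rewrite (_ : _ `&` _ =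
    (`[0, 1]%classic `&` C) `*` (@unit_cube R n)); last first.
  by apply/seteqP; split=> -[x y] /=; rewrite tnth0; case=> -[].
rewrite borel_lebesgue_rect ?borel_lebesgue_unit_cube ?mule1//.
- by apply: le_measure; rewrite ?inE//; apply: measurableI.
- exact: measurableI.
- exact: measurable_unit_cube.
Qed.

Definition coord2 n (e : 'I_n * 'I_n) (x : n.-tuple mR) : mR * mR :=
  (tnth x e.1, tnth x e.2).

Lemma measurable_coord2 n (e : 'I_n * 'I_n) :
  measurable_fun [set: n.-tuple mR] (coord2 e).
Proof. by apply: measurable_fun_pair; exact: measurable_tnth. Qed.

(** If both coordinates come after the first, the first one contributes a factor
    1. If i is the first, freeze its value t: the section is the
    one-coordinate cylinder over the t-section of B, and the measure of B is the
    integral over t of the measures of its sections. *)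
Lemma borel_lebesgue_coord2_le n (e : 'I_n * 'I_n) (B : set (mR * mR)) :
  (e.1 < e.2)%N -> measurable B ->
  (borel_lebesgue R n (@unit_cube R n `&` coord2 e @^-1` B) <=
   borel_lebesgue2 R B)%E.
Proof.
move=> + mB; elim: n e => [[[]//]|n IH] [i j] /= ij.
rewrite /= /borel_lebesgue_step /pushforward preimage_setI tuple_cons_unit_cube.
case: (unliftP ord0 j) ij => [j' ->|->]; last by rewrite ltn0.
case: (unliftP ord0 i) => [i'|] -> ij.
  rewrite (_ : _ `&` _ = `[0, 1]%classic `*`
      (@unit_cube R n `&` coord2 (i', j') @^-1` B)); last first.
    apply/seteqP; split=> -[x y] /=; rewrite /coord2/= !tnthS.
      by case=> -[].
    by case=> ? [].
  rewrite borel_lebesgue_rect ?lebesgue_measure_itv01 ?mul1e//.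
    exact: IH.
  by apply: measurable_cube_preimage => //; exact: measurable_coord2.
set S := _ `&` _.
have mS : measurable (S : set (mR * n.-tuple mR)).
  apply: measurableI.
    by apply: measurableX => //; exact: measurable_unit_cube.
  rewrite -[X in measurable X]setTI -comp_preimage.
  apply: (measurableT_comp (measurable_coord2 _)) => //.
  exact: measurable_tuple_cons.
rewrite /borel_lebesgue2/= /product_measure1.
(* Both sides are integrals of the measures of sections over the first
   coordinate; they are compared section by section. *)
apply: ge0_le_integral => //.
- exact: measurable_fun_xsection.
- exact: measurable_fun_xsection.
move=> x _ /=.
apply: le_trans (borel_lebesgue_coord_le j' (measurable_xsection x mB)).
apply: le_measure; rewrite ?inE.
- exact: measurable_xsection.
- apply: measurable_cube_preimage; last exact: measurable_xsection.
  exact: measurable_tnth.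
- move=> y; rewrite /xsection/= /S/= inE/= /coord2/= tnth0 tnthS.
  move=> -[[_ y01] Bxy].
  by split=> //; rewrite inE.
Qed.

End borel.

(** * Projections of the cube: Lebesgue measurable sets *)

Section cylinders.
Context (R : realType).
Local Notation square := (@unit_square R).
Local Notation cube n := (@unit_cube R n).

Lemma measurable_unit_square :
  measurable (square : set (measurableTypeR R * measurableTypeR R)).
Proof. by apply: measurableX; exact: measurable_itv. Qed.

Lemma lebesgue2_unit_square : lebesgue2 R square = 1%E.
Proof.
rewrite /lebesgue2/= /completed_measure_extension measurable_mu_extE//=.
  transitivity (@lebesgue_measure R `[0%R, 1%R]%classic *
                @lebesgue_measure R `[0%R, 1%R]%classic)%E.
    by apply: product_measure1E; exact: measurable_itv.
  by rewrite lebesgue_measure_itv01 mule1.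
exact: measurable_unit_square.
Qed.

Lemma lebesgue_measurable_unit_cube n :
  measurable (cube n : set (Defs.space R n)).
Proof.
apply: sub_caratheodory; apply: sub_sigma_algebra; exact: measurable_unit_cube.
Qed.

Lemma lebesgue_measurable_unit_square : measurable (square : set (plane R)).
Proof.
apply: sub_caratheodory; apply: sub_sigma_algebra.
exact: measurable_unit_square.
Qed.

Lemma lebesgue_unit_cube n : lebesgue R n (cube n) = 1%E.
Proof.
rewrite /lebesgue/= /completed_measure_extension measurable_mu_extE//=.
  exact: borel_lebesgue_unit_cube.
exact: measurable_unit_cube.
Qed.

Lemma lebesgue_coord2_le n (e : 'I_n * 'I_n) (A : set (R * R)) :
  (e.1 < e.2)%N ->
  (lebesgue R n (cube n `&` coord2 e @^-1` A) <= lebesgue2 R A)%E.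
Proof.
move=> lt_e; apply: le_mu_ext_preimage.
- exact: measurable_unit_cube.
- exact: measurable_coord2.
- by move=> B mB; exact: borel_lebesgue_coord2_le.
Qed.

Lemma lebesgue2_fin_num (A : set (R * R)) :
  A `<=` square -> lebesgue2 R A \is a fin_num.
Proof.
move=> Asq; rewrite ge0_fin_numE; last exact: mu_ext_ge0.
apply: (@le_lt_trans _ _ (lebesgue2 R square)); first exact: le_mu_ext.
by rewrite lebesgue2_unit_square ltry.
Qed.

Lemma measurable_coord2_preimage n (e : 'I_n * 'I_n) (A : set (R * R)) :
  (e.1 < e.2)%N -> measurable (A : set (plane R)) -> A `<=` square ->
  measurable (cube n `&` coord2 e @^-1` A : set (Defs.space R n)).
Proof.
move=> lt_e mA Asq.
apply: (@caratheodory_preimage _ _ _ _ _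
  (borel_lebesgue R n) (borel_lebesgue2 R)).
- exact: measurable_unit_cube.
- exact: measurable_coord2.
- by move=> B mB; exact: borel_lebesgue_coord2_le.
- exact: mA.
- by rewrite -ge0_fin_numE ?outer_measure_ge0//; exact: lebesgue2_fin_num.
Qed.

Lemma coord2_unit_cube n (e : 'I_n * 'I_n) x : cube n x -> square (coord2 e x).
Proof. by move=> x01; split=> /=; exact: x01. Qed.

(** Only points of the square are hit from the cube, so the preimages at stake
    are those of subsets of the square, which have finite area. *)
Lemma measurable_fun_coord2 n (e : 'I_n * 'I_n) (W : R * R -> R) :
  (e.1 < e.2)%N ->
  @measurable_fun _ _ (plane R) (measurableTypeR R) square W ->
  @measurable_fun _ _ (Defs.space R n) (measurableTypeR R) (cube n)
    (W \o coord2 e).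
Proof.
move=> lt_e mW _ Y mY.
rewrite (_ : _ `&` _ = cube n `&` coord2 e @^-1` (square `&` W @^-1` Y)).
  apply: measurable_coord2_preimage => //.
  by apply: mW => //; exact: lebesgue_measurable_unit_square.
apply/seteqP; split=> x /=; last by case=> ? [].
by move=> [x01 Yx]; split=> //; split=> //; exact: (coord2_unit_cube e x01).
Qed.

End cylinders.

(** * Differences of products and their integrals *)

(** One factor is exchanged at a time, by a p - b q = (a - b) p + b (p - q); the
    remaining factors, being in [0, 1], do not amplify the difference. *)
Lemma dist_prod_le (R : realDomainType) (I : Type) (s : seq I) (P : pred I)
    (a b : I -> R) :
  (forall i, P i -> 0 <= a i <= 1) -> (forall i, P i -> 0 <= b i <= 1) ->
  `|\prod_(i <- s | P i) a i - \prod_(i <- s | P i) b i| <=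
    \sum_(i <- s | P i) `|a i - b i|.
Proof.
move=> a01 b01; elim: s => [|i s IH]; first by rewrite !big_nil subrr normr0.
rewrite !big_cons; case: ifPn => // Pi.
set p := \prod_(j <- s | P j) a j; set q := \prod_(j <- s | P j) b j.
rewrite (_ : a i * p - b i * q = (a i - b i) * p + b i * (p - q)); last first.
  by rewrite mulrBl mulrBr addrA subrK.
apply: (le_trans (ler_normD _ _)); rewrite !normrM lerD//.
  rewrite ler_piMr// ger0_norm ?prodr_ge0//; last by move=> j /a01/andP[].
  exact: prodr_ile1.
have /andP[bi0 bi1] := b01 _ Pi.
by rewrite (ger0_norm bi0) (le_trans _ IH)// ler_piMl.
Qed.

Lemma Rintegral_le_sum_indic d (T : measurableType d) (R : realType)
    (mu : {measure set T -> \bar R}) (D : set T) (g : T -> R)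
    (I : finType) (E : {set I}) (B : I -> set T) (c a : R) :
  measurable D -> mu.-integrable D (EFin \o g) -> 0 <= c ->
  (forall i, i \in E -> measurable (B i)) ->
  (forall i, i \in E -> (mu (B i `&` D) <= a%:E)%E) ->
  (forall x, D x -> `|g x| <= \sum_(i in E) c * \1_(B i) x) ->
  `|\int[mu]_(x in D) g x| <= #|E|%:R * c * a.
Proof.
move=> mD ig c0 mB Ba gB.
(* Outside E nothing is known of B; emptying it there makes every B' i
   measurable. *)
pose B' i := if i \in E then B i else set0.
have mB' i : measurable (B' i) by rewrite /B'; case: ifPn => // /mB.
have mh i : measurable_fun D (fun x => (\1_(B' i) x : R)%:E).
  exact/measurable_EFinP/measurable_indic.
have mch i : measurable_fun D (fun x => (c%:E * (\1_(B' i) x : R)%:E)%E).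
  exact: measurable_funeM.
have h0 i x : (0 <= c%:E * (\1_(B' i) x)%:E)%E by rewrite lee_fin mulr_ge0.
rewrite -lee_fin EFin_normr_Rintegral//.
apply: (le_trans (le_abse_integral _ mD (measurable_int _ ig))).
apply: (@le_trans _ _
    (\int[mu]_(x in D) \sum_(i <- enum E) (c%:E * (\1_(B' i) x : R)%:E))%E).
  apply: ge0_le_integral => //.
  - by apply: measurableT_comp => //; exact: measurable_int ig.
  - exact: emeasurable_sum.
  - move=> x Dx; rewrite big_enum/= sumEFin lee_fin (le_trans (gB _ Dx))//.
    by apply: ler_sum => i iE; rewrite /B' iE.
rewrite ge0_integral_sum// big_enum/= -mulrA mulr_natl -sumr_const -sumEFin.
apply: lee_sum => i iE.
rewrite ge0_integralZl_EFin// ?integral_indic//.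
by rewrite EFinM lee_wpmul2l ?lee_fin// /B' iE Ba.
Qed.

(** * Composition of a fuzzy set with a graphon *)

Section fuzzy.
Context (R : realType).
Implicit Types W f : R * R -> R.
Local Notation square := (@unit_square R).

Lemma unit_square0 : square (0, 0).
Proof. by split; rewrite /= in_itv/= lexx ler01. Qed.

Lemma le_fuzzy_sup f p : fuzzy_subset f -> square p -> f p <= fuzzy_sup f.
Proof.
move=> f01 sp; apply: ub_le_sup; last by exists p.
by exists 1 => _ [q sq <-]; have /andP[] := f01 _ sq.
Qed.

Lemma fuzzy_sup_ge0 f : fuzzy_subset f -> 0 <= fuzzy_sup f.
Proof.
move=> f01; apply: le_trans (le_fuzzy_sup f01 unit_square0).
by have /andP[] := f01 _ unit_square0.
Qed.

(** If some value of f reaches W s then the supremum is attained with value W s;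
    otherwise every minimum is f x, and the supremum is that of f. *)
Lemma fuzzy_compE f W s : fuzzy_subset f ->
  fuzzy_comp f W s = Num.min (fuzzy_sup f) (W s).
Proof.
move=> f01; set S := [set Num.min (f x) (W s) | x in square].
have S0 : S !=set0.
  by exists (Num.min (f (0, 0)) (W s)), (0, 0); first exact: unit_square0.
have ubS : ubound S (Num.min (fuzzy_sup f) (W s)).
  by move=> _ [x sx <-]; rewrite le_min !ge_min le_fuzzy_sup// lexx orbT.
have leS x : square x -> Num.min (f x) (W s) <= sup S.
  move=> sx; apply: ub_le_sup; last by exists x.
  by exists (Num.min (fuzzy_sup f) (W s)).
apply/eqP; rewrite eq_le; apply/andP; split; first exact: sup_le_ub.
have [[x sx Wf]|nWf] := pselect (exists2 x, square x & W s <= f x).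
  by rewrite ge_min -[X in _ || (X <= _)](min_idPr Wf) leS ?orbT.
rewrite ge_min; apply/orP; left; apply: sup_le_ub.
  by exists (f (0, 0)), (0, 0); first exact: unit_square0.
move=> _ [x sx <-]; apply: le_trans (leS x sx).
rewrite le_min lexx leNgt; apply/negP => Wf; apply: nWf.
by exists x => //; exact: ltW.
Qed.

End fuzzy.

(** * Comparison of densities *)

Section density.
Context (R : realType) (k : nat) (F : simple_graph k).
Implicit Types W : R * R -> R.
Local Notation square := (@unit_square R).
Local Notation cube := (@unit_cube R k).
Local Notation measurable_on_square :=
  (@measurable_fun _ _ (plane R) (measurableTypeR R) square).

Lemma edges_lt e : e \in edges F -> (e.1 < e.2)%N.
Proof. by rewrite inE => /andP[]. Qed.

Lemma integrable_density W : measurable_on_square W -> fuzzy_subset W ->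
  (lebesgue R k).-integrable cube
    (EFin \o (fun x => \prod_(e in edges F) W (coord2 e x))).
Proof.
move=> mW W01; apply: measurable_bounded_integrable.
- exact: lebesgue_measurable_unit_cube.
- by rewrite lebesgue_unit_cube ltry.
- under eq_fun do rewrite -big_enum/=.
  apply: measurable_prod => e; rewrite mem_enum => /edges_lt lt_e.
  exact: measurable_fun_coord2.
- exists 1; split=> // M M1 x x01; apply: le_trans (ltW M1).
  have prod01 e : e \in edges F -> 0 <= W (coord2 e x) <= 1.
    by move=> _; apply/W01/coord2_unit_cube.
  rewrite ger0_norm ?prodr_ile1//.
  by apply: prodr_ge0 => e /prod01/andP[].
Qed.

(** The integrands differ at x by at most d for each edge whose two coordinates
    form a point of A, and within the cube the x with this property have measure
    at most the area of A. *)
Lemma density_dist_le W V (d : R) (A : set (R * R)) :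
  measurable_on_square W -> fuzzy_subset W ->
  measurable_on_square V -> fuzzy_subset V ->
  0 <= d -> measurable (A : set (plane R)) -> A `<=` square ->
  (forall p, square p -> `|W p - V p| <= d * \1_A p) ->
  `|density F W - density F V| <= #|edges F|%:R * d * area A.
Proof.
move=> mW W01 mV V01 d0 mA Asq WV.
have mcube := @lebesgue_measurable_unit_cube R k.
have iW := integrable_density mW W01; have iV := integrable_density mV V01.
rewrite /density -RintegralB//.
set g := fun x => _ - _.
have ig : (lebesgue R k).-integrable cube (EFin \o g).
  exact: (integrableB mcube iW iV).
pose cyl (e : 'I_k * 'I_k) : set (Defs.space R k) := cube `&` coord2 e @^-1` A.
have mcyl e : e \in edges F -> measurable (cyl e).
  by move=> /edges_lt lt_e; exact: measurable_coord2_preimage.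
have lcyl e : e \in edges F -> (lebesgue R k (cyl e) <= (area A)%:E)%E.
  move=> /edges_lt lt_e; rewrite /area fineK ?lebesgue2_fin_num//.
  exact: lebesgue_coord2_le.
apply: (Rintegral_le_sum_indic (B := cyl) mcube ig d0 mcyl) => [e eF|x x01].
  by rewrite (setIidl (@subIsetl _ _ _)) lcyl.
have sq e : square (coord2 e x) by exact: coord2_unit_cube.
apply: (le_trans (dist_prod_le _ _ _)) => [e _|e _|].
- exact: W01 (sq e).
- exact: V01 (sq e).
apply: ler_sum => e _; rewrite (le_trans (WV _ (sq e)))//.
by rewrite !indicE /cyl in_setI (mem_set x01) andTb.
Qed.

End density.

Theorem theorem3p6 (R : realType) (W : R * R -> R) (f : R * R -> R)
    (k : nat) (F : simple_graph k)
    (graphonW : graphon W) (fuzzyf : fuzzy_subset f) :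
  `|density F W - density F (fuzzy_comp f W)| <=
    #|edges F|%:R * (fuzzy_sup W - fuzzy_sup f) *
    area [set p : R * R | unit_square p /\ fuzzy_sup f < W p].
Proof.
have [mW W01 _] := graphonW.
have c0 := fuzzy_sup_ge0 fuzzyf.
set c := fuzzy_sup f in c0 *; set A := [set p | _].
have -> : fuzzy_comp f W = fun p => Num.min c (W p).
  by apply/funext => p; exact: fuzzy_compE.
have V01 : fuzzy_subset (fun p => Num.min c (W p)).
  by move=> p /W01/andP[W0 W1]; rewrite le_min c0 W0 ge_min W1 orbT.
have mV : @measurable_fun _ _ (plane R) (measurableTypeR R) (@unit_square R)
    (fun p => Num.min c (W p)).
  by apply: measurable_minr => //; exact: measurable_cst.
have mA : measurable (A : set (plane R)).
  rewrite (_ : A = @unit_square R `&` W @^-1` `]c, +oo[%classic); last first.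
    by apply/seteqP; split=> p /=; rewrite in_itv/= andbT.
  by apply: mW; [exact: lebesgue_measurable_unit_square|exact: measurable_itv].
have Asq : A `<=` @unit_square R by move=> p [].
(* When A is empty, fuzzy_sup W - c may be negative, and the densities agree;
   a point of A shows that it is positive. *)
have [A0|/set0P[p [sp cp]]] := eqVneq A set0.
  have -> : area A = 0 by rewrite /area A0 measure0.
  rewrite mulr0; have := @density_dist_le R k F W _ 0 A mW W01 mV V01 _ mA Asq.
  rewrite mulr0 mul0r; apply=> // p sp; rewrite mul0r.
  rewrite min_r ?subrr ?normr0// leNgt; apply/negP => cW.
  by have : A p by []; rewrite A0.
have cW : c <= fuzzy_sup W by apply: le_trans (ltW cp) (le_fuzzy_sup W01 sp).
apply: density_dist_le => //; first by rewrite subr_ge0.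
move=> q sq; rewrite indicE; have [Wc|cWq] := leP (W q) c.
  by rewrite subrr normr0 mulr_ge0// subr_ge0.
rewrite mem_set//= mulr1 ger0_norm ?subr_ge0 ?(ltW cWq)//.
by rewrite lerD2r le_fuzzy_sup.
Qed.
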